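(* Let $H\in(0,\tfrac12)$, $x_0,a,\sigma>0$, and let $X^H$ be the rough Bessel process. For $T>0$ put $$\widehat a(T):=\frac{X^H(T)}{\int_0^T\frac{1}{X^H(t)}\,dt}.$$ Then, with probability 1, $\widehat a(T)\to a$ as $T\to\infty$.
   Context: $B^H=\{B^H(t),\ t\ge0\}$ is a fractional Brownian motion with Hurst index $H\in(0,\frac12)$: a centered Gaussian process with $\mathbb E[B^H(t)B^H(s)]=\frac12(t^{2H}+s^{2H}-|t-s|^{2H})$, always taken in its modification with paths locally Hölder continuous of every order $\lambda\in(0,H)$. For constants $x_0,a,\sigma>0$ and each $\varepsilon>0$, $X^H_\varepsilon$ is the unique pathwise solution of $$X^H_\varepsilon(t)=x_0+\int_0^t\frac{a}{X^H_\varepsilon(s)\mathbf 1_{\{X^H_\varepsilon(s)>0\}}+\varepsilon}\,ds+\sigma B^H(t),\qquad t\ge0.$$ For $\varepsilon_1<\varepsilon_2$ one has $X^H_{\varepsilon_1}(t)\ge X^H_{\varepsilon_2}(t)$ for all $t$, so the pointwise limit $X^H(t):=\lim_{\varepsilon\downarrow0}X^H_\varepsilon(t)$ exists; it is called the rough (fractional) Bessel process. With probability 1, $X^H(t)<\infty$ and $X^H(t)\ge0$ for all $t\ge0$, $X^H(t)>0$ for almost all $t\ge0$, and $\int_0^t\frac{1}{X^H(s)}ds<\infty$ for all $t\ge0$. *)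

(* Defs.v *)
From HB Require Import structures.
From mathcomp Require Import all_boot all_order all_algebra.
From mathcomp Require Import all_classical all_reals all_analysis.

Set Implicit Arguments.
Unset Strict Implicit.
Unset Printing Implicit Defensive.

Import Order.TTheory GRing.Theory Num.Theory.
Import numFieldNormedType.Exports.

Local Open Scope classical_set_scope.
Local Open Scope ring_scope.

(* Degenerate laws are allowed. They are handled separately because the
   library's [normal_prob m 0] is the uniform law on [0, 1], not [\d_m]. *)
Definition gaussian_law (R : realType) (mu : set R -> \bar R) : Prop :=
  exists m s : R, 0 <= s /\
    forall A : set R, measurable A ->
      mu A = if s == 0 then \d_m A else normal_prob m s A.

(* Processes are indexed by the whole of R, but only the times t >= 0 are ever
   constrained or used. *)
Definition gaussian_process (d : measure_display) (T : measurableType d)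
    (R : realType) (P : probability T R) (B : R -> {RV P >-> R}) : Prop :=
  forall (n : nat) (t c : 'I_n -> R), (forall i, 0 <= t i) ->
    gaussian_law (pushforward P (fun w => \sum_(i < n) c i * B (t i) w)).

Definition fractional_brownian_motion (d : measure_display)
    (T : measurableType d) (R : realType) (P : probability T R) (H : R)
    (B : R -> {RV P >-> R}) : Prop :=
  [/\ gaussian_process B,
      forall t, 0 <= t -> ('E_P[B t] = 0)%E &
      forall t s, 0 <= t -> 0 <= s ->
        'E_P[fun w => (B t w * B s w)%R]%E =
        (2^-1 * (t `^ (2 * H) + s `^ (2 * H) - `|t - s| `^ (2 * H)))%:E].

Definition locally_holder (R : realType) (lambda : R) (f : R -> R) : Prop :=
  forall K : R, 0 < K -> exists C : R,
    forall s t, 0 <= s <= K -> 0 <= t <= K ->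
      `|f t - f s| <= C * `|t - s| `^ lambda.

(* For eps > 0 and b continuous the integrand is a bounded Lipschitz function
   of x s, so there is exactly one such x on [0, +oo[. *)
Definition approx_bessel_path (R : realType) (x0 a sigma eps : R)
    (b x : R -> R) : Prop :=
  {within `[0, +oo[, continuous x} /\
  forall t, 0 <= t ->
    x t = x0 + \int[lebesgue_measure]_(s in `[0, t])
                 (a / (x s * \1_[set y | 0 < y] (x s) + eps)) + sigma * b t.

(* The limit is taken in \bar R, where it always exists by monotonicity in eps;
   its finiteness and nonnegativity are theorems, not part of the definition. *)
Definition rough_bessel (R : realType) (x : R -> R -> R) (t : R) : \bar R :=
  lim ((x eps t)%:E @[eps --> 0^'+]).

(* Division in \bar R: 1/0 = +oo and 1/+oo = 0. *)
Definition drift_estimator (R : realType) (X : R -> \bar R) (T : R) : \bar R :=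
  (X T / \int[lebesgue_measure]_(t in `[0%R, T]) (X t)^-1)%E.

(* Main.v *)
Require Import Defs.
From HB Require Import structures.
From mathcomp Require Import all_boot all_order all_algebra.
From mathcomp Require Import all_classical all_reals all_analysis.
From mathcomp Require Import measurable_realfun ring lra.

Set Implicit Arguments.
Unset Strict Implicit.
Unset Printing Implicit Defensive.

Import Order.TTheory GRing.Theory Num.Theory.
Import numFieldNormedType.Exports.

Local Open Scope classical_set_scope.
Local Open Scope ring_scope.

(* Write X = c + Y with c t = x0 + sigma B t and Y the nondecreasing drift part.
   The approximations give X >= k sqrt T for large T as soon as
   sup_[0, T] |c| = o(sqrt T): either the path has reached 2 k sqrt T, and the
   noise cannot bring it below k sqrt T, or it has stayed below, and then the
   drift is at least of order 1 / sqrt T throughout [0, T]. Past a time T0 the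
   approximations are thus bounded away from 0, dominated convergence gives
   X T - c T = a \int_0^T 1 / X + const, where Fatou's lemma bounds the
   contribution of [0, T0], and c T / X T -> 0 yields the limit.
   For H < 1/2, sup_[0, T] |B| = o(sqrt T) almost surely, by Gaussian tails,
   dyadic chaining on [0, 2^N] and the Borel-Cantelli lemma in N. *)

(** * Continuity and last passage times *)

(** Freezing a path before time 0 turns continuity on the half-line into continuity on [R], the form
    assumed by the pathwise lemmas. *)
Lemma continuous_comp_max0 (R : realType) (f : R -> R) :
  {within `[0, +oo[, continuous f} -> continuous (fun t : R => f (Num.max t 0)).
Proof.
move=> /subspace_continuousP cf t.
have A0 y : `[0, +oo[%classic (Num.max y 0 : R).
  by rewrite /= in_itv/= andbT le_max lexx orbT.
have ct : {for t, continuous (fun y : R => Num.max y 0)}.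
  by apply: continuous_max; [exact: cvg_id|exact: cvg_cst].
apply: cvg_comp (cf _ (A0 t)) => U UA.
apply: (@filterS _ (nbhs t) _ _ _ _ (ct _ UA)) => y /=.
by apply; exact: A0.
Qed.

(** [tau] is the supremum of the times in [[s, t]] where [f] is at least [l]. Pathwise comparisons
    start from it: on []tau, t]] the path stays on one side of a level, so the drift there can be
    bounded. *)
Lemma last_exit (R : realType) (f : R -> R) (s t l : R) : continuous f ->
  s <= t -> l <= f s -> f t < l ->
  exists2 tau, s <= tau < t & l <= f tau /\ forall u, tau < u <= t -> f u < l.
Proof.
move=> cf st fs ft; pose S := [set u | s <= u <= t /\ l <= f u].
have Ss : S s by split=> //; rewrite lexx st.
have ubS : ubound S t by move=> u [/andP[]].
have hS : has_sup S by split; [exists s|exists t].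
have sS : s <= sup S by apply: ub_le_sup => //; exists t.
have St : sup S <= t by apply: ge_sup => //; exists s.
have fS : l <= f (sup S).
  rewrite leNgt; apply/negP => fSl.
  have fl : nbhs (sup S) [set u | f u < l].
    exact: (cvgr_lt _ (cf (sup S)) _ fSl).
  move: fl => /nbhs_ballP[e /= e0 He].
  have [u Su] := sup_adherent e0 hS.
  move=> ueS; have uS : u <= sup S by apply: ub_le_sup => //; exists t.
  have : f u < l by apply: He; rewrite /ball/= ltr_norml; apply/andP; split; lra.
  by case: Su => _ lf; rewrite ltNge lf.
exists (sup S); last split => //.
  rewrite sS lt_neqAle St andbT; apply/eqP => E; move: ft.
  by rewrite -E ltNge fS.
move=> u /andP[Su ut]; rewrite ltNge; apply/negP => lu.
have : u <= sup S by apply: ub_le_sup; [exists t|split => //; lra].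
by rewrite leNgt Su.
Qed.

(** * Regularized Bessel paths *)

Section deterministic.
Context {R : realType}.
Implicit Types (a e s t : R) (c x : R -> R).
Notation mu := (@lebesgue_measure R).

(** [Num.max y 0] stands for [y] times the indicator of [0 < y], in a form that is visibly
    continuous and monotone. *)
Definition drift a e y : R := a / (Num.max y 0 + e).

Lemma drift_indicE a e y : a / (y * \1_[set z | 0 < z] y + e) = drift a e y.
Proof.
rewrite /drift indicE; case: (ltP 0 y) => y0.
  by rewrite mem_set// mulr1.
by rewrite memNset/= ?ltNge ?y0 ?mulr0.
Qed.

Lemma drift_den_gt0 e y : 0 < e -> 0 < Num.max y 0 + e.
Proof. by move=> e0; rewrite ltr_wpDl// le_max lexx orbT. Qed.

Lemma drift_ge0 a e y : 0 < a -> 0 < e -> 0 <= drift a e y.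
Proof. by move=> a0 e0; rewrite divr_ge0 ?ltW// drift_den_gt0. Qed.

Lemma ler_drift a e1 e2 y1 y2 : 0 < a -> 0 < e1 -> e1 <= e2 -> y1 <= y2 ->
  drift a e2 y2 <= drift a e1 y1.
Proof.
move=> a0 e10 e12 y12; rewrite ler_pM2l// lef_pV2 ?posrE ?drift_den_gt0//.
  by rewrite lerD// ge_max le_max y12/= le_max lexx orbT.
exact: lt_le_trans e12.
Qed.

Lemma continuous_drift a e x : 0 < e -> continuous x ->
  continuous (fun t => drift a e (x t)).
Proof.
move=> e0 cx t; rewrite /drift; apply: cvgM; first exact: cvg_cst.
apply: cvgV; first by rewrite gt_eqF// drift_den_gt0.
apply: cvgD; last exact: cvg_cst.
by apply: continuous_max; [exact: cx|exact: cvg_cst].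
Qed.

Lemma continuous_integrable_itv (f : R -> R) s t : continuous f ->
  mu.-integrable `[s, t] (EFin \o f).
Proof.
move=> cf; apply: continuous_compact_integrable; first exact: segment_compact.
exact: continuous_subspaceT.
Qed.

Lemma Rintegral_segmentB (f : R -> R) s t : continuous f -> 0 <= s <= t ->
  \int[mu]_(u in `[0, t]) f u - \int[mu]_(u in `[0, s]) f u =
  \int[mu]_(u in `[s, t]) f u.
Proof.
move=> cf /andP[s0 st]; rewrite Rintegral_itvB//.
- rewrite Rintegral_itv_obnd_cbnd//.
  apply: integrableS (continuous_integrable_itv s t cf) => //.
  exact: subset_itv_oc_cc.
- exact: continuous_integrable_itv.
Qed.

Lemma Rintegral_segment_cst s t r : s <= t ->
  \int[mu]_(u in `[s, t]) r = r * (t - s).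
Proof.
move=> st; rewrite Rintegral_cst//= lebesgue_measure_itv/= lte_fin.
move: st; rewrite le_eqVlt => /predU1P[->|st]; first by rewrite ltxx subrr.
by rewrite st.
Qed.

(* The bounds are only needed on the open-closed interval: the left endpoint is
   a null set, and it is the point where the order may fail. *)
Lemma le_Rintegral_oc (f g : R -> R) s t : continuous f -> continuous g ->
  (forall u, s < u <= t -> f u <= g u) ->
  \int[mu]_(u in `[s, t]) f u <= \int[mu]_(u in `[s, t]) g u.
Proof.
move=> cf cg fg.
have I h : continuous h -> mu.-integrable `]s, t] (EFin \o h).
  move=> ch; apply: integrableS (continuous_integrable_itv s t ch) => //.
  exact: subset_itv_oc_cc.
rewrite -!Rintegral_itv_obnd_cbnd//; [|exact: I|exact: I].
apply: le_Rintegral; [by []|exact: I|exact: I|].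
by move=> u /=; rewrite in_itv/=; exact: fg.
Qed.

(** The function [c] merges the starting point with the scaled noise. *)
Definition bessel_solution a e c x :=
  continuous x /\
  forall t, 0 <= t -> x t = c t + \int[mu]_(u in `[0, t]) drift a e (x u).

Lemma bessel_solutionB a e c x s t : 0 < e -> bessel_solution a e c x ->
  0 <= s <= t ->
  x t - x s = c t - c s + \int[mu]_(u in `[s, t]) drift a e (x u).
Proof.
move=> e0 [cx ex] st0; have /andP[s0 st] := st0.
rewrite -(Rintegral_segmentB _ st0); last exact: continuous_drift.
by rewrite (ex t) 1?(ex s) ?(le_trans s0)//; ring.
Qed.

Lemma bessel_solution0 a e c x : bessel_solution a e c x -> x 0 = c 0.
Proof. by move=> [_ ->//]; rewrite set_itv1 Rintegral_set1 addr0. Qed.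

Lemma bessel_solution_incr_ge a e c x s t m : 0 < e ->
  bessel_solution a e c x -> 0 <= s <= t ->
  (forall u, s < u <= t -> m <= drift a e (x u)) ->
  c t - c s + m * (t - s) <= x t - x s.
Proof.
move=> e0 S st0 Hm; have /andP[s0 st] := st0.
rewrite (bessel_solutionB e0 S st0) lerD2l -Rintegral_segment_cst//.
apply: le_Rintegral_oc => //; first by move=> ?; exact: cvg_cst.
by apply: continuous_drift => //; case: S.
Qed.

Lemma bessel_solution_incr_le a e c x s t m : 0 < e ->
  bessel_solution a e c x -> 0 <= s <= t ->
  (forall u, s < u <= t -> drift a e (x u) <= m) ->
  x t - x s <= c t - c s + m * (t - s).
Proof.
move=> e0 S st0 Hm; have /andP[s0 st] := st0.
rewrite (bessel_solutionB e0 S st0) lerD2l -Rintegral_segment_cst//.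
apply: le_Rintegral_oc => //; last by move=> ?; exact: cvg_cst.
by apply: continuous_drift => //; case: S.
Qed.

Lemma bessel_solution_incr_ge0 a e c x s t : 0 < a -> 0 < e ->
  bessel_solution a e c x -> 0 <= s <= t -> c t - c s <= x t - x s.
Proof.
move=> a0 e0 S st; have := bessel_solution_incr_ge e0 S st.
move=> /(_ 0); rewrite mul0r addr0; apply => u _; exact: drift_ge0.
Qed.

(** After the last time [tau] at which [x2 <= x1], the path [x1] is the lower one, so it has the
    larger drift and the gap [D] cannot become negative. *)
Lemma bessel_solution_mono a e1 e2 c x1 x2 t : 0 < a -> 0 < e1 -> e1 <= e2 ->
  bessel_solution a e1 c x1 -> bessel_solution a e2 c x2 -> 0 <= t ->
  x2 t <= x1 t.
Proof.
move=> a0 e10 e12 S1 S2 t0; rewrite leNgt; apply/negP => x12.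
have e20 : 0 < e2 by exact: lt_le_trans e12.
pose D u := x1 u - x2 u.
have cD : continuous D.
  by move=> u; apply: cvgB; [case: S1 => + _; apply|case: S2 => + _; apply].
have [tau /andP[tau0 taut] [Dtau Du]] : exists2 tau, 0 <= tau < t &
    0 <= D tau /\ forall u, tau < u <= t -> D u < 0.
  apply: last_exit => //; last by rewrite /D subr_lt0.
  by rewrite /D (bessel_solution0 S1) (bessel_solution0 S2) subrr.
have tt : 0 <= tau <= t by rewrite tau0 ltW.
have := bessel_solutionB e10 S1 tt; have := bessel_solutionB e20 S2 tt.
have : \int[mu]_(u in `[tau, t]) drift a e2 (x2 u) <=
       \int[mu]_(u in `[tau, t]) drift a e1 (x1 u).
  apply: le_Rintegral_oc.
  - by apply: continuous_drift => //; case: S2.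
  - by apply: continuous_drift => //; case: S1.
  - move=> u /Du; rewrite /D subr_lt0 => /ltW; exact: ler_drift.
have : D t < 0 by rewrite /D subr_lt0.
by move: Dtau; rewrite /D; lra.
Qed.

(** Above level 1 the drift is at most [a], whatever [e] is. From the last time at or below [1 + M],
    the noise adds at most [2 * M] and the drift at most [a * t]. Uniformity in [e] is what makes
    the limit finite. *)
Lemma bessel_solution_bounded a e c x t M : 0 < a -> 0 < e ->
  bessel_solution a e c x -> 0 <= t -> (forall u, 0 <= u <= t -> `|c u| <= M) ->
  x t <= 1 + 3 * M + a * t.
Proof.
move=> a0 e0 S t0 cM.
have M0 : 0 <= M by apply: le_trans (cM 0 _); rewrite ?lexx.
have x0 : x 0 <= 1 + M.
  rewrite (bessel_solution0 S) (le_trans (ler_norm _))//.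
  by rewrite (le_trans (cM 0 _)) ?lexx// lerDr.
rewrite leNgt; apply/negP => xt.
have at0 : 0 <= a * t by rewrite mulr_ge0// ltW.
have [tau /andP[tau0 taut] [Dtau Du]] : exists2 tau, 0 <= tau < t &
    - (1 + M) <= (- x tau) /\ forall u, tau < u <= t -> - x u < - (1 + M).
  apply: (@last_exit _ (fun u => - x u)) => //.
  - by move=> u; apply: cvgN; case: S => + _; apply.
  - by rewrite lerN2.
  - by rewrite ltrN2; lra.
have tt : 0 <= tau <= t by rewrite tau0 ltW.
have := @bessel_solution_incr_le _ _ _ _ _ _ a e0 S tt.
have : drift a e 1 <= a.
  rewrite /drift ler_pdivrMr ?drift_den_gt0// ler_peMr ?ltW//.
  by rewrite (max_idPl _)//; lra.
move=> da /(_ _)/wrap[].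
  move=> u /Du; rewrite ltrN2 => xu; apply: le_trans da.
  by apply: ler_drift => //; lra.
have := cM tau; have := cM t; rewrite t0 lexx tau0 (ltW taut) !ler_norml.
move=> /(_ isT)/andP[? ?] /(_ isT)/andP[? ?].
have : a * (t - tau) <= a * t by rewrite ler_pM2l//; lra.
move: Dtau; rewrite lerN2; lra.
Qed.

End deterministic.

Lemma continuous_segment_bounded (R : realType) (f : R -> R) (s t : R) :
  continuous f -> exists M, forall u, s <= u <= t -> `|f u| <= M.
Proof.
move=> cf; have cfs : {within `[s, t], continuous f}.
  exact: continuous_subspaceT.
have := continuous_compact cfs (@segment_compact R s t).
move=> /compact_bounded[M [Mr HM]]; exists (M + 1) => u su.
by apply: (HM (M + 1)); [rewrite ltrDl|exists u => //=; rewrite in_itv].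
Qed.

(** * The limit path *)

Section bessel_limit.
Context {R : realType}.
Notation mu := (@lebesgue_measure R).
Variables (a : R) (c : R -> R) (x : R -> R -> R).
Hypotheses (a0 : 0 < a) (cc : continuous c) (c0 : 0 <= c 0).
Hypothesis xS : forall e, 0 < e -> bessel_solution a e c (x e).

Definition bessel_limit t : R := lim (x e t @[e --> 0^'+]).

(** The family is monotone in [e] and bounded uniformly in [e]. *)
Lemma bessel_limit_cvg t : 0 <= t -> x e t @[e --> 0^'+] --> bessel_limit t.
Proof.
move=> t0; have [M HM] := continuous_segment_bounded 0 t cc.
apply/cvg_ex; eexists; apply: (@nonincreasing_at_right_cvgr _ _ _ (BRight 1)).
- by rewrite bnd_simp.
- move=> e1 e2; rewrite !in_itv/= => /andP[e10 _] _ e12.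
  apply: (bessel_solution_mono a0 e10 _ (xS e10) (xS _) t0) => //.
  exact: lt_le_trans e12.
- exists (1 + 3 * M + a * t) => _ /= [e + <-].
  rewrite in_itv/= => /andP[e0 _].
  exact: (bessel_solution_bounded a0 e0 (xS e0) t0 HM).
Qed.

Lemma le_bessel_limit e t : 0 < e -> 0 <= t -> x e t <= bessel_limit t.
Proof.
move=> e0 t0; apply: limr_ge.
  by apply/cvg_ex; eexists; exact: bessel_limit_cvg.
near=> e1; apply: (bessel_solution_mono a0 _ _ (xS _) (xS e0) t0) => //.
by near: e1; exact: nbhs_right_le.
Unshelve. all: by end_near. Qed.

(* While the limit is below a negative level, the approximations are pushed up
   at rate [a / e] for a time independent of [e]. *)
Lemma bessel_limit_ge0 t : 0 <= t -> 0 <= bessel_limit t.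
Proof.
rewrite le_eqVlt => /predU1P[<-|t0].
  apply: le_trans (le_bessel_limit ltr01 (lexx 0)).
  by rewrite (bessel_solution0 (xS ltr01)).
rewrite leNgt; apply/negP => X0; set d := - bessel_limit t / 2.
have d0 : 0 < d by rewrite divr_gt0// oppr_gt0.
have ct : nbhs t [set u | `|c t - c u| <= d].
  by have /cvgrPdist_le := @cc t; apply.
move: ct => /nbhs_ballP[r /= r0 Hr].
pose h := Num.min (r / 2) t.
have h0 : 0 < h by rewrite lt_min t0 divr_gt0.
have ht : h <= t by rewrite ge_min lexx orbT.
have hr : h <= r / 2 by rewrite ge_min lexx.
have th0 : 0 <= t - h by rewrite subr_ge0.
(* With this [e], the push [a / e] during a time [h] amounts to [|c t| + 1], enough to bring [x e t]
   above 0. *)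
pose e := a * h / (`|c t| + 1).
have ct0 : 0 < `|c t| + 1 by rewrite ltr_wpDl.
have e0 : 0 < e by rewrite divr_gt0// mulr_gt0.
have xt : x e t <= bessel_limit t by exact: (le_bessel_limit e0 (ltW t0)).
have dX : bessel_limit t = - 2 * d by rewrite /d; field.
have x1 : c t - c (t - h) + a / e * (t - (t - h)) <= x e t - x e (t - h).
  apply: (bessel_solution_incr_ge e0 (xS e0) _ _); first by rewrite th0 gerBl ltW.
  (* Backwards from [t]: [x e u <= x e t + (c u - c t) <= - 2 * d + d < 0], so the drift at [u] is
     exactly [a / e]. *)
  move=> u /andP[hu ut].
  have : c t - c u <= x e t - x e u.
    by apply: (bessel_solution_incr_ge0 a0 e0 (xS e0) _) => //; rewrite ut andbT; lra.
  have : `|c t - c u| <= d.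
    by apply: Hr; rewrite /ball/= ltr_norml; apply/andP; split; lra.
  rewrite ler_norml => /andP[? ?] ?.
  by rewrite /drift (max_idPr _) ?add0r//; lra.
have x2 : c (t - h) - c 0 <= x e (t - h) - x e 0.
  by apply: (bessel_solution_incr_ge0 a0 e0 (xS e0) _) => //; rewrite lexx.
have ae : a / e * (t - (t - h)) = `|c t| + 1.
  rewrite /e; field.
  by rewrite !gt_eqF.
have := bessel_solution0 (xS e0).
have := ler_norm (- c t); rewrite normrN; lra.
Qed.

End bessel_limit.

(** * Growth of the regularized path at least like the square root *)

Section lower_bound.
Context {R : realType}.
Implicit Types (c : R -> R).

(** This is sup over [[0, T]] of [|c|] = o(sqrt T), written without a supremum. *)
Definition sub_sqrt c := forall d : R, 0 < d -> exists2 T0 : R, 0 < T0 &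
  forall T, T0 <= T -> forall u, 0 <= u <= T -> `|c u| <= d * Num.sqrt T.

(* If x stays below [2 k sqrt T] then the drift pushes it above [k sqrt T];
   once above, the driving noise is too small to bring it back. *)
Lemma bessel_solution_ge_sqrt a c x : 0 < a -> bessel_solution a 1 c x ->
  sub_sqrt c ->
  exists k T0 : R, [/\ 0 < k, 0 < T0 &
    forall T, T0 <= T -> k * Num.sqrt T <= x T].
Proof.
(* [k <= a / 6] makes a drift [a / (3 * k * sqrt T)] contribute at least [2 * sqrt T] over [[0, T]];
   [k <= 1] lets this exceed [k * sqrt T] plus the noise. *)
move=> a0 S sc; pose k := Num.min 1 (a / 6).
have k0 : 0 < k by rewrite lt_min ltr01 divr_gt0.
have k1 : k <= 1 by rewrite ge_min lexx.
have k6 : k <= a / 6 by rewrite ge_min lexx orbT.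
have k20 : 0 < k / 2 by rewrite divr_gt0.
have [T1 T10 HT1] := sc _ k20.
(* [T >= k ^- 2] gives [1 <= k * sqrt T], which absorbs the regularization parameter 1:
   [2 * k * sqrt T + 1 <= 3 * k * sqrt T]. *)
exists k, (Num.max T1 (k ^- 2)); split => //; first by rewrite lt_max T10.
move=> T; rewrite ge_max => /andP[T1T kT].
have T0 : 0 < T by exact: lt_le_trans T1T.
have cT u : 0 <= u <= T -> `|c u| <= k / 2 * Num.sqrt T by exact: HT1.
set q := Num.sqrt T in cT *.
have q0 : 0 < q by rewrite sqrtr_gt0.
have qq : T = q * q by rewrite -expr2 sqr_sqrtr// ltW.
have kq : 1 <= k * q.
  rewrite -(@ler_pXn2r _ 2)// ?nnegrE ?ler01//; last exact/ltW/mulr_gt0.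
  have : k ^- 2 * k ^+ 2 <= T * k ^+ 2 by rewrite ler_pM2r// exprn_gt0.
  have k2 : k ^+ 2 != 0 by rewrite expf_neq0// gt_eqF.
  rewrite mulVf// expr1n qq.
  by have -> : q * q * k ^+ 2 = (k * q) ^+ 2 by ring.
have TT : 0 <= T <= T by rewrite lexx ltW.
have cTT := cT T TT; rewrite ler_norml in cTT.
have := cT 0; rewrite lexx (ltW T0) => /(_ isT); rewrite ler_norml.
move=> /andP[c01 c02]; move: cTT => /andP[cT1 cT2].
have [[tau [tT xtau]]|/forallNP small] :=
    pselect (exists u, 0 <= u <= T /\ 2 * k * q <= x u).
  have : c T - c tau <= x T - x tau by apply: (bessel_solution_incr_ge0 a0 ltr01 S _).
  have := cT _ tT; rewrite ler_norml => /andP[? ?]; lra.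
have xs u : 0 <= u <= T -> x u <= 2 * k * q.
  by move=> uT; rewrite leNgt; apply/negP => xu; apply: (small u); rewrite (ltW xu).
have : c T - c 0 + (a / (3 * k * q)) * (T - 0) <= x T - x 0.
  apply: (bessel_solution_incr_ge (ltr01) S _ _); first by rewrite lexx ltW.
  move=> u /andP[u0 uT]; rewrite /drift ler_pM2l//.
  rewrite lef_pV2 ?posrE ?drift_den_gt0 ?mulr_gt0//.
  have := xs u; rewrite (ltW u0) uT => /(_ isT) xu.
  have : Num.max (x u) 0 <= 2 * k * q by rewrite ge_max xu/= !mulr_ge0 ?ltW.
  lra.
have -> : a / (3 * k * q) * (T - 0) = a / (3 * k) * q.
  by rewrite {1}qq; field; rewrite !gt_eqF.
have : 2 <= a / (3 * k) by rewrite ler_pdivlMr ?mulr_gt0//; lra.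
rewrite -(ler_pM2r q0) => ? ; rewrite (bessel_solution0 S).
have : k * q <= q by rewrite ler_piMl// ltW.
lra.
Qed.

End lower_bound.

(** * The integral of the inverse of the limit path *)

Section bessel_limit_integral.
Context {R : realType}.
Notation mu := (@lebesgue_measure R).
Variables (a : R) (c : R -> R) (x : R -> R -> R).
Hypotheses (a0 : 0 < a) (cc : continuous c) (c0 : 0 <= c 0).
Hypothesis xS : forall e, 0 < e -> bessel_solution a e c (x e).
Local Notation X := (bessel_limit x).
Local Notation e_ n := (n.+1%:R^-1 : R).
Local Notation approx_inv n t := ((Num.max (x (e_ n) t) 0 + e_ n)^-1%:E).

Let e_gt0 n : 0 < e_ n. Proof. by rewrite invr_gt0. Qed.

(** Fatou's lemma and dominated convergence concern sequences, so [e] tends to 0 along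
    [1 / (n + 1)]. *)
Lemma bessel_limit_seq_cvg t : 0 <= t -> x (e_ n) t @[n --> \oo] --> X t.
Proof.
move=> t0; have /cvg_at_rightP := bessel_limit_cvg a0 cc xS t0.
by apply; split => //; exact: cvg_harmonic.
Qed.

(** This also holds at a zero of the limit: there the approximations are nonpositive, the
    denominator is exactly [e_ n], and its inverse tends to [+oo], the extended inverse of 0. *)
Lemma approx_inv_cvg t : 0 <= t ->
  approx_inv n t @[n --> \oo] --> ((X t)%:E^-1)%E.
Proof.
move=> t0; have := bessel_limit_ge0 a0 cc c0 xS t0.
rewrite le_eqVlt inver eq_sym => /predU1P[Xt0|Xt0].
  rewrite Xt0 eqxx.
  have E n : approx_inv n t = (n.+1%:R : R)%:E.
    have := le_bessel_limit a0 cc xS (e_gt0 n) t0; rewrite Xt0 => xt.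
    by rewrite (max_idPr xt) add0r invrK.
  under eq_fun do rewrite E.
  by apply/cvgenyP/cvgnyPge => M; exists M => // n /=; exact: leqW.
rewrite gt_eqF//; apply: cvg_EFin; first exact: nearW.
apply: cvgV; first by rewrite gt_eqF.
rewrite -[X in _ --> X]addr0; apply: cvgD; last exact: cvg_harmonic.
have cm : {for X t, continuous (fun y : R => Num.max y 0)}.
  by apply: continuous_max; [exact: cvg_id|exact: cvg_cst].
have := cvg_comp _ _ (bessel_limit_seq_cvg t0) cm.
by rewrite (max_idPl (ltW Xt0)).
Qed.

Lemma measurable_approx_inv n (s t : R) :
  measurable_fun `[s, t] (fun u => approx_inv n u).
Proof.
apply/measurable_EFinP; apply: measurable_funTS.
apply: continuous_measurable_fun.
under eq_fun do rewrite -div1r -/(drift 1 _ _).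
exact: continuous_drift (e_gt0 n) (xS (e_gt0 n)).1.
Qed.

Lemma measurable_bessel_limit_inv (s t : R) : 0 <= s ->
  measurable_fun `[s, t] (fun u => ((X u)%:E^-1)%E).
Proof.
move=> s0; apply: (emeasurable_fun_cvg (fun n u => approx_inv n u)).
  by move=> n; exact: measurable_approx_inv.
move=> u /=; rewrite in_itv/= => /andP[su _].
by apply: approx_inv_cvg; exact: le_trans su.
Qed.

Lemma bessel_limit_inv_ge0 u : 0 <= u -> (0 <= (X u)%:E^-1)%E.
Proof. by move=> u0; rewrite inve_ge0 lee_fin; exact: bessel_limit_ge0 xS _ u0. Qed.

(** The integral equation on [[s, t]], solved for the integral: the drift is [a] times the
    integrand. *)
Lemma integral_approx_inv n s t : 0 <= s <= t ->
  (\int[mu]_(u in `[s, t]) approx_inv n u =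
   ((x (e_ n) t - x (e_ n) s - (c t - c s)) / a)%:E)%E.
Proof.
move=> st; have S := xS (e_gt0 n).
have cd := @continuous_drift _ a _ _ (e_gt0 n) S.1.
have cd1 := @continuous_drift _ 1 _ _ (e_gt0 n) S.1.
rewrite (bessel_solutionB (e_gt0 n) S st) addrAC subrr add0r.
rewrite mulrC -RintegralZl//; last exact: continuous_integrable_itv.
rewrite -[LHS]fineK; last first.
  apply: integrable_fin_num => //.
  have := continuous_integrable_itv s t cd1; congr (_.-integrable _ _).
  by apply/funext => u /=; rewrite /drift div1r.
congr EFin; apply: eq_Rintegral => u _; rewrite /drift mulrA mulVf ?mul1r//.
by rewrite gt_eqF.
Qed.

(** Fatou's lemma applies even if the limit comes near 0 on [[0, t]]. The inequality serves to show
    that the integral over an initial segment is finite. *)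
Lemma integral_bessel_limit_inv_le t : 0 <= t ->
  (\int[mu]_(u in `[0%R, t]) (X u)%:E^-1 <= ((X t - c t) / a)%:E)%E.
Proof.
move=> t0; have tt : 0 <= (0 : R) <= t by rewrite lexx.
have -> : (\int[mu]_(u in `[0%R, t]) (X u)%:E^-1 =
    \int[mu]_(u in `[0%R, t]) limn_einf (fun n => approx_inv n u))%E.
  apply: eq_integral => u; rewrite inE/= in_itv/= => /andP[u0 _].
  by rewrite (cvg_limn_einf_sup (approx_inv_cvg u0)).
apply: le_trans; first apply: fatou => //.
- by move=> n; exact: measurable_approx_inv.
- by move=> n u _; rewrite lee_fin invr_ge0 ltW// drift_den_gt0.
have lim : (\int[mu]_(u in `[0%R, t]) approx_inv n u)%E @[n --> \oo] -->
    ((X t - c t) / a)%:E.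
  under eq_fun do rewrite (integral_approx_inv _ tt).
  apply: cvg_EFin; first exact: nearW.
  apply: cvgMr_tmp; under eq_fun => n.
    rewrite /= (bessel_solution0 (xS (e_gt0 n))).
    rewrite opprB addrA subrK; over.
  by apply: cvgB; [exact: bessel_limit_seq_cvg|exact: cvg_cst].
by rewrite (cvg_limn_einf_sup lim).
Qed.

(** By monotonicity in [e], the lower bound on [x 1] passes to every [x (e_ n)], and the constant
    [k^-1] dominates the integrands. *)
Lemma integral_bessel_limit_invE s t k : 0 <= s <= t -> 0 < k ->
  (forall u, s <= u <= t -> k <= x 1 u) ->
  (\int[mu]_(u in `[s, t]) (X u)%:E^-1 =
   ((X t - X s - (c t - c s)) / a)%:E)%E.
Proof.
move=> st k0 Hk; have /andP[s0 st'] := st.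
have [] := @dominated_convergence _ _ _ mu `[s, t] _ (fun n u => approx_inv n u)
  (fun u => (X u)%:E^-1)%E (cst (k^-1)%:E).
- exact: measurable_itv.
- by move=> n; exact: measurable_approx_inv.
- exact: measurable_bessel_limit_inv.
- apply: aeW => u /=; rewrite in_itv/= => /andP[su _].
  by apply: approx_inv_cvg; exact: le_trans su.
- have := @continuous_integrable_itv R (cst k^-1) s t.
  by apply => ?; exact: cvg_cst.
- apply: aeW => u n /=; rewrite in_itv/= => ust; have /andP[su _] := ust.
  rewrite lee_fin ger0_norm; last by rewrite invr_ge0 ltW// drift_den_gt0.
  rewrite lef_pV2 ?posrE ?drift_den_gt0//.
  apply: le_trans (Hk _ ust) _.
  have : x 1 u <= x (e_ n) u.
    apply: (bessel_solution_mono a0 (e_gt0 n) _ (xS _) (xS ltr01)) => //.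
      by rewrite invf_le1// ler1n.
    exact: le_trans su.
  have : x (e_ n) u <= Num.max (x (e_ n) u) 0 by rewrite le_max lexx.
  by move=> h2 h1; rewrite (le_trans h1)// (le_trans h2)// lerDl ltW.
move=> _ _ lim; apply: (cvg_unique _ lim) => //.
rewrite /=; under eq_fun do rewrite (integral_approx_inv _ st).
apply: cvg_EFin; first exact: nearW.
apply: cvgMr_tmp; apply: cvgB; last exact: cvg_cst.
apply: cvgB; apply: bessel_limit_seq_cvg => //; exact: le_trans st'.
Qed.

End bessel_limit_integral.

(** * Convergence of the estimator along a path *)

Section bessel_limit_estimator.
Context {R : realType}.
Notation mu := (@lebesgue_measure R).
Variables (a : R) (c : R -> R) (x : R -> R -> R).
Hypotheses (a0 : 0 < a) (cc : continuous c) (c0 : 0 <= c 0) (sc : sub_sqrt c).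
Hypothesis xS : forall e, 0 < e -> bessel_solution a e c (x e).
Local Notation X := (bessel_limit x).
Local Notation J s t := (\int[mu]_(u in `[s%R, t%R]) (X u)%:E^-1)%E.

Lemma integral_bessel_limit_inv_split (s t : R) : 0 <= s <= t ->
  J 0 t = (J 0 s + J s t)%E.
Proof.
move=> /andP[s0 st].
have mJ u v := measurable_bessel_limit_inv a0 cc c0 xS (t := v) (s := u).
have E : `[0, t]%classic = `[0, s[%classic `|` `[s, t]%classic :> set R.
  by rewrite -itv_bndbnd_setU// bnd_simp.
have mU : measurable_fun (`[0, s[ `|` `[s, t]) (fun u => (X u)%:E^-1)%E.
  by rewrite -E; exact: mJ.
have U0 u : (`[0, s[ `|` `[s, t]) u -> (0 <= (X u)%:E^-1)%E.
  rewrite -E /= in_itv/= => /andP[u0 _].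
  exact: (bessel_limit_inv_ge0 a0 cc c0 xS).
rewrite E ge0_integral_setU//; last first.
  by apply/disj_setPS => y [/=]; rewrite !in_itv/= => /andP[_ ys] /andP[];
    rewrite leNgt ys.
rewrite integral_itv_bndo_bndc//; apply: measurable_funS (mJ 0 s _) => //.
exact: subset_itv_co_cc.
Qed.

(* Past the time T0 after which the paths stay above [k sqrt T], the limit
   equation [X T - c T = a J 0 T + const] holds exactly, and [c] is negligible
   with respect to [X]. *)
Lemma bessel_limit_estimator_cvg :
  ((X T)%:E / J 0 T)%E @[T --> +oo] --> a%:E.
Proof.
have [k [T0 [k0 T00 XT]]] := bessel_solution_ge_sqrt a0 (xS ltr01) sc.
have J0 : J 0 T0 \is a fin_num.
  rewrite ge0_fin_numE.
    apply: le_lt_trans (integral_bessel_limit_inv_le a0 cc c0 xS (ltW T00)) _.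
    exact: ltry.
  apply: integral_ge0 => u /=; rewrite in_itv/= => /andP[u0 _].
  exact: (bessel_limit_inv_ge0 a0 cc c0 xS).
pose K := a * fine (J 0 T0) - X T0 + c T0.
pose i T := (X T - c T + K) / a.
have JE T : T0 <= T -> J 0 T = (i T)%:E.
  move=> T0T; have T0T' : 0 <= T0 <= T by rewrite T0T ltW.
  rewrite (integral_bessel_limit_inv_split T0T') -(fineK J0).
  rewrite (integral_bessel_limit_invE a0 cc c0 xS T0T' (k := k * Num.sqrt T0)).
  - by rewrite -EFinD; congr EFin; rewrite /i /K; field; rewrite gt_eqF.
  - by rewrite mulr_gt0// sqrtr_gt0.
  - move=> u /andP[T0u _]; apply: le_trans (XT _ T0u).
    by rewrite ler_pM2l// ler_wsqrtr.
have XkT T : T0 <= T -> k * Num.sqrt T <= X T.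
  move=> T0T; apply: le_trans (XT _ T0T) _.
  by apply: (le_bessel_limit a0 cc xS ltr01); rewrite (le_trans (ltW T00)).
have key e : 0 < e -> \forall T \near +oo,
    0 < i T /\ `|a - X T / i T| <= e.
  (* The error is [a * (K - c T) / (X T - c T + K)]. It is at most [e] in absolute value as soon as
     [(a + e) * |c T - K| <= e * X T]; [d] is chosen so that bounding both [|c T|] and [|K|] by
     [d * sqrt T] ensures this. *)
  move=> e0; pose d := e * k / (2 * (a + e)).
  have ae0 : 0 < a + e by rewrite addr_gt0.
  have d0 : 0 < d by rewrite divr_gt0 ?mulr_gt0.
  have [T1 T10 HT1] := sc d0.
  near=> T.
  have T0T : T0 <= T by near: T; exact/nbhs_pinfty_ge/num_real.
  have T1T : T1 <= T by near: T; exact/nbhs_pinfty_ge/num_real.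
  have KT : (K / d) ^+ 2 <= T by near: T; exact/nbhs_pinfty_ge/num_real.
  have T_gt0 : 0 < T by exact: lt_le_trans T0T.
  have Kd : `|K| <= d * Num.sqrt T.
    rewrite mulrC -ler_pdivrMr// -{1}(gtr0_norm d0) -normf_div -sqrtr_sqr.
    exact: ler_wsqrtr.
  have cd : `|c T| <= d * Num.sqrt T by apply: HT1 => //; rewrite lexx ltW.
  have X0 := XkT _ T0T.
  have q0 : 0 < Num.sqrt T by rewrite sqrtr_gt0.
  have kq0 : 0 < k * Num.sqrt T by rewrite mulr_gt0.
  have XT0 : 0 < X T by exact: lt_le_trans X0.
  have dk : (a + e) * (2 * (d * Num.sqrt T)) = e * (k * Num.sqrt T).
    by rewrite /d; field; rewrite gt_eqF.
  have cK : (a + e) * `|c T - K| <= e * X T.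
    apply: (@le_trans _ _ (e * (k * Num.sqrt T))); last by rewrite ler_pM2l.
    rewrite -dk ler_pM2l//; apply: le_trans (ler_normB _ _) _; lra.
  have cKX : `|c T - K| < X T.
    rewrite -(ltr_pM2l ae0); apply: le_lt_trans cK _.
    by rewrite ltr_pM2r// ltrDr.
  have den0 : 0 < X T - c T + K by have := ler_norm (c T - K); lra.
  split; first by rewrite divr_gt0.
  have -> : a - X T / i T = a * (K - c T) / (X T - c T + K).
    by rewrite /i; field; rewrite !gt_eqF.
  rewrite normrM normfV normrM (gtr0_norm a0) (gtr0_norm den0) distrC.
  rewrite ler_pdivrMr//.
  have := ler_norm (c T - K); rewrite -(ler_pM2l e0); nra.
(* Extended division agrees with real division once [i T] is nonzero; [key] at 1 is invoked for
   positivity alone. *)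
have near_i : \forall T \near +oo, (X T / i T)%:E = ((X T)%:E / J 0 T)%E.
  near=> T; have T0T : T0 <= T by near: T; exact/nbhs_pinfty_ge/num_real.
  have [i0 _] : 0 < i T /\ `|a - X T / i T| <= 1 by near: T; exact: key.
  by rewrite JE// inver gt_eqF.
apply: cvg_trans (near_eq_cvg near_i) _.
apply: cvg_EFin; first exact: nearW.
apply/cvgrPdist_le => e e0; near=> T.
by have [] : 0 < i T /\ `|a - X T / i T| <= e by near: T; exact: key.
Unshelve. all: by end_near. Qed.

End bessel_limit_estimator.

(** * From frozen paths back to the processes of the statement *)

Lemma sub_sqrt_affine (R : realType) (b : R -> R) (r s : R) : 0 < s ->
  sub_sqrt b -> sub_sqrt (fun t => r + s * b t).
Proof.
(* The constant [r] and the term [s * b] each receive half of [d * sqrt T]. *)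
move=> s0 sb d d0; have d2s : 0 < d / (2 * s) by rewrite divr_gt0// mulr_gt0.
have [T0 T00 HT0] := sb _ d2s; pose T1 := (2 * r / d) ^+ 2.
exists (Num.max T0 T1); first by rewrite lt_max T00.
move=> T; rewrite ge_max => /andP[T0T T1T] u uT.
have := HT0 _ T0T _ uT.
have rd : `|2 * r| <= d * Num.sqrt T.
  rewrite [leRHS]mulrC -ler_pdivrMr// -{1}(gtr0_norm d0) -normf_div -sqrtr_sqr.
  exact: ler_wsqrtr.
rewrite -(ler_pM2l s0).
have -> : s * (d / (2 * s) * Num.sqrt T) = d / 2 * Num.sqrt T.
  by field; rewrite gt_eqF.
move=> bu; apply: le_trans (ler_normD _ _) _.
rewrite normrM (gtr0_norm s0).
move: rd; rewrite normrM ger0_norm//; lra.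
Qed.

(** The purely pathwise form of the result. Noise and approximations are frozen before time 0, which
    changes nothing at the times [t >= 0]. *)
Lemma drift_estimator_cvg (R : realType) (x0 a sigma : R) (b : R -> R)
    (x : R -> R -> R) : 0 < x0 -> 0 < a -> 0 < sigma ->
  {within `[0, +oo[, continuous b} -> b 0 = 0 -> sub_sqrt b ->
  (forall eps, 0 < eps -> approx_bessel_path x0 a sigma eps b (x eps)) ->
  drift_estimator (rough_bessel x) T @[T --> +oo] --> a%:E.
Proof.
move=> x00 a0 s0 cb b0 sb xS.
pose c (t : R) := x0 + sigma * b (Num.max t 0).
pose y (e t : R) := x e (Num.max t 0).
have cc : continuous c.
  move=> t; apply: cvgD; first exact: cvg_cst.
  apply: cvgMl_tmp; exact: (continuous_comp_max0 cb).
have c0 : 0 <= c 0 by rewrite /c (max_idPl (lexx 0)) b0 mulr0 addr0 ltW.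
have sc : sub_sqrt c.
  move=> d d0; have [T0 T00 HT0] := @sub_sqrt_affine _ _ x0 _ s0 sb _ d0.
  exists T0 => // T T0T u uT; rewrite /c (max_idPl _); last by case/andP: uT.
  exact: HT0.
have yS e : 0 < e -> bessel_solution a e c (y e).
  move=> e0; have [cx xE] := xS e e0; split; first exact: continuous_comp_max0.
  move=> t t0; rewrite /y /c (max_idPl t0) (xE _ t0) addrAC; congr (_ + _).
  apply: eq_Rintegral => u; rewrite inE/= in_itv/= => /andP[u0 _].
  by rewrite drift_indicE (max_idPl u0).
have XE t : 0 <= t -> rough_bessel x t = (bessel_limit y t)%:E.
  move=> t0; apply/cvg_lim => //; apply: cvg_EFin; first exact: nearW.
  have := bessel_limit_cvg a0 cc yS t0.
  by rewrite /y (max_idPl t0).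
apply: cvg_trans (bessel_limit_estimator_cvg a0 cc c0 sc yS).
apply: near_eq_cvg; near=> T.
have T0 : 0 <= T by near: T; exact/nbhs_pinfty_ge/num_real.
rewrite /drift_estimator XE//; congr (_ / _)%E.
apply: eq_integral => u; rewrite inE/= in_itv/= => /andP[u0 _].
by rewrite XE.
Unshelve. all: by end_near. Qed.

Lemma measurable_norm_ge (R : realType) (q : R) :
  measurable [set x : R | q <= `|x|].
Proof.
have -> : [set x : R | q <= `|x|] = (@Num.norm R R) @^-1` `[q, +oo[.
  by apply/seteqP; split => x /=; rewrite in_itv/= andbT.
rewrite -[X in measurable X]setTI; exact: normr_measurable.
Qed.

(** * Gaussian tails *)

Section gaussian_tail.
Context {R : realType}.
Implicit Types (m s q y z x : R).
Notation leb := (@lebesgue_measure R).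

(** Since [pi >= 2], the square root of [2 * pi * s ^+ 2] is at least [2 * s]. *)
Lemma normal_peak_le s : 0 < s -> normal_peak s <= (2 * s)^-1.
Proof.
move=> s0; have h : 2 * s <= Num.sqrt (s ^+ 2 * pi *+ 2).
  rewrite -(@ger0_norm _ (2 * s)) ?mulr_ge0 ?(ltW s0)// -sqrtr_sqr ler_wsqrtr//.
  have : s ^+ 2 * 2 <= s ^+ 2 * pi by rewrite ler_pM2l ?exprn_gt0// pi_ge2.
  rewrite -mulr_natr; lra.
by rewrite lef_pV2 ?posrE ?mulr_gt0// (lt_le_trans _ h) ?mulr_gt0.
Qed.

(** Doubling the deviation halves the peak and turns the exponent [- v / 2] into [- v / 8], where
    [v] is the squared standardized distance; the ratio of the densities is
    [2 * expR (- (3 * v / 8))]. *)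
Lemma normal_pdf_le_dilated m s x z : 0 < s -> 0 <= z -> z * s <= `|x - m| ->
  normal_pdf m s x <= 2 * expR (- (3 * z ^+ 2 / 8)) * normal_pdf m (2 * s) x.
Proof.
move=> s0 z0 zx; rewrite !normal_pdfE ?gt_eqF ?mulr_gt0//.
have -> : normal_peak (2 * s) = normal_peak s / 2.
  rewrite /normal_peak -invfM; congr (_^-1).
  have -> : (2 * s) ^+ 2 * pi *+ 2 = (s ^+ 2 * pi *+ 2) * 2 ^+ 2.
    by ring.
  rewrite sqrtrM; last by rewrite mulrn_wge0// mulr_ge0 ?sqr_ge0 ?pi_ge0.
  by rewrite sqrtr_sqr ger0_norm.
have -> : 2 * expR (- (3 * z ^+ 2 / 8)) *
    (normal_peak s / 2 * normal_fun m (2 * s) x) =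
  normal_peak s * (expR (- (3 * z ^+ 2 / 8)) * normal_fun m (2 * s) x).
  by field.
rewrite ler_wpM2l ?normal_peak_ge0// /normal_fun -expRD ler_expR.
set v := (x - m) ^+ 2 / s ^+ 2.
have zv : z ^+ 2 <= v.
  rewrite /v ler_pdivlMr ?exprn_gt0// -exprMn -(real_normK (num_real (x - m))).
  by rewrite ler_pXn2r ?nnegrE// mulr_ge0// ltW.
have -> : - (x - m) ^+ 2 / (s ^+ 2 *+ 2) = - v / 2.
  by rewrite /v -mulr_natr; field; rewrite gt_eqF.
have -> : - (x - m) ^+ 2 / ((2 * s) ^+ 2 *+ 2) = - v / 8.
  by rewrite /v -mulr_natr; field; rewrite gt_eqF.
lra.
Qed.

(** Integrate the comparison with the dilated density, whose total mass is 1. *)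
Lemma normal_prob_tail m s z : 0 < s -> 0 <= z ->
  (normal_prob m s [set x | (z * s <= `|x - m|)%R] <=
   (2 * expR (- (3 * z ^+ 2 / 8)))%:E)%E.
Proof.
move=> s0 z0; set A := [set x | _].
have mA : measurable A.
  have := @measurable_norm_ge R (z * s) => mN.
  have mf : measurable_fun [set: R] (fun x : R => x - m).
    exact: measurable_funB.
  by have := mf measurableT _ mN; rewrite setTI.
set K := 2 * _; have K0 : 0 <= K by rewrite mulr_ge0// expR_ge0.
have mp v : measurable_fun A (fun x => (normal_pdf m v x)%:E).
  by apply/measurable_EFinP; apply: measurable_funTS; exact: measurable_normal_pdf.
apply: (@le_trans _ _ (\int[leb]_(x in A) (K%:E * (normal_pdf m (2 * s) x)%:E)))%E.
  apply: ge0_le_integral => //.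
  - by move=> x _; rewrite lee_fin normal_pdf_ge0.
  - exact: mp.
  - by apply: measurable_funeM; exact: mp.
  - by move=> x Ax; rewrite lee_fin; exact: normal_pdf_le_dilated.
rewrite ge0_integralZl//; [|exact: mp|
  by move=> x _; rewrite lee_fin normal_pdf_ge0].
rewrite -[leRHS]mule1 lee_pmul2l//; last by rewrite lte_fin mulr_gt0// expR_gt0.
exact: (@probability_le1 _ _ _ (normal_prob m (2 * s))).
Qed.

Lemma normal_prob_segment_le m s q M : 0 < q ->
  (forall x, `|x| <= q -> normal_pdf m s x <= M) ->
  (normal_prob m s `[(- q)%R, q] <= (M * (2 * q))%:E)%E.
Proof.
move=> q0 HM.
apply: (@le_trans _ _ (\int[leb]_(x in `[(- q)%R, q]) (cst M%:E) x))%E.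
  apply: ge0_le_integral => //.
  - by move=> x _; rewrite lee_fin normal_pdf_ge0.
  - by apply/measurable_EFinP; apply: measurable_funTS; exact: measurable_normal_pdf.
  - by move=> x /=; rewrite in_itv/= => xq; rewrite lee_fin HM// ler_norml.
rewrite integral_cst//= lebesgue_measure_itv/= lte_fin.
by rewrite ifT; [rewrite -EFinD -EFinM lee_fin opprK; lra|lra].
Qed.

(* A Gaussian law with no more than a quarter of its mass outside [-q, q] has
   its mean and its deviation bounded by multiples of q: compare the mass of
   [-q, q] with the maximum of the density there. *)
Lemma gaussian_law_tail (mu : set R -> \bar R) q y : gaussian_law mu ->
  0 < q -> 4 <= y -> (mu [set x | (q <= `|x|)%R] <= (4^-1)%:E)%E ->
  (mu [set x | (q * y <= `|x|)%R] <= (2 * expR (- (y ^+ 2 / 32)))%:E)%E.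
Proof.
move=> [m [s [s0 muE]]] q0 y4.
rewrite !muE; [|exact: measurable_norm_ge..].
have e0 : 0 <= 2 * expR (- (y ^+ 2 / 32)) by rewrite mulr_ge0// expR_ge0.
move: s0; rewrite le_eqVlt eq_sym; case: eqVneq => [_ _|sN0 /= s0].
  (* A point mass with at most a quarter of its mass outside []-q, q[] sits inside, so its tail
     vanishes. *)
  rewrite !diracE; have [mq|mq] := leP q `|m|.
    by rewrite mem_set//= lee_fin => h; exfalso; lra.
  move=> _; rewrite memNset ?lee_fin//=; apply/negP; rewrite -ltNge.
  by apply: lt_trans mq _; rewrite ltr_pMr//; lra.
move=> mass.
have inner : ((3 / 4)%:E <= normal_prob m s `[(- q)%R, q])%E.
  have : (1 - normal_prob m s [set x | (q <= `|x|)%R] <= normal_prob m s `[(- q)%R, q])%E.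
    rewrite -[X in (X <= _)%E](@probability_setC _ _ _ (normal_prob m s));
      last exact: measurable_norm_ge.
    apply: (@le_measure _ _ _ (normal_prob m s)); rewrite ?inE//.
      by apply: measurableC; exact: measurable_norm_ge.
    move=> x /= /negP; rewrite -ltNge in_itv/= -ler_norml; exact: ltW.
  apply: le_trans; rewrite leeBrDr//; last first.
    rewrite ge0_fin_numE ?measure_ge0//; apply: le_lt_trans mass _.
    exact: ltry.
  apply: le_trans (leeD2l _ mass) _; rewrite -EFinD lee_fin; lra.
have pk := normal_peak_le s0.
have sq : 3 * s <= 4 * q.
  have := le_trans inner (normal_prob_segment_le q0 (fun x _ => normal_pdf_ub m x sN0)).
  rewrite lee_fin => h.
  have : normal_peak s * (2 * q) <= (2 * s)^-1 * (2 * q).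
    by rewrite ler_pM2r// mulr_gt0.
  move=> /(le_trans h).
  have -> : (2 * s)^-1 * (2 * q) = q / s by field; rewrite gt_eqF.
  rewrite ler_pdivlMr//; lra.
(* Otherwise [|x - m| >= q] on [[-q, q]], and the mass there is at most [u * expR (- (u ^+ 2 / 2))],
   which stays below 3/4 because [expR v >= 1 + v]. *)
have mq : `|m| <= 2 * q.
  rewrite leNgt; apply/negP => qm; pose u := q / s.
  have u0 : 0 < u by rewrite divr_gt0.
  have := le_trans inner (@normal_prob_segment_le m s q
    ((2 * s)^-1 * expR (- (u ^+ 2 / 2))) q0 _).
  have pdf_le x : `|x| <= q -> normal_pdf m s x <= (2 * s)^-1 * expR (- (u ^+ 2 / 2)).
    move=> xq; rewrite normal_pdfE//.
    apply: ler_pM; rewrite ?normal_peak_ge0 ?normal_fun_ge0//.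
    rewrite /normal_fun ler_expR.
    have -> : - (x - m) ^+ 2 / (s ^+ 2 *+ 2) = - ((x - m) ^+ 2 / s ^+ 2 / 2).
      by rewrite -mulr_natr; field.
    rewrite lerN2 ler_pM2r// /u expr_div_n ler_pM2r ?invr_gt0 ?exprn_gt0//.
    rewrite -(real_normK (num_real (x - m))) ler_pXn2r ?nnegrE// ?(ltW q0)//.
    have := lerB_dist m x; rewrite (distrC m); lra.
  move=> /(_ pdf_le); rewrite lee_fin expRN.
  have -> : (2 * s)^-1 * (expR (u ^+ 2 / 2))^-1 * (2 * q) = u / expR (u ^+ 2 / 2).
    by rewrite /u; field; rewrite gt_eqF ?expR_gt0.
  rewrite ler_pdivlMr ?expR_gt0// => hu.
  have := expR_ge1Dx (u ^+ 2 / 2).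
  have : 0 <= (3 * u - 4) ^+ 2 by exact: sqr_ge0.
  nra.
have y0 : 0 <= y by lra.
(* As [y >= 4], [|x| >= q * y] forces [|x - m| >= q * y / 2], which is at least [3 * y / 8]
   deviations. The resulting exponent [27 / 512 * y ^+ 2] exceeds [y ^+ 2 / 32]. *)
apply: (@le_trans _ _ (normal_prob m s [set x | (3 * y / 8 * s <= `|x - m|)%R])).
  apply: (@le_measure _ _ _ (normal_prob m s)); rewrite ?inE//.
  - exact: measurable_norm_ge.
  - have mf : measurable_fun [set: R] (fun x : R => x - m) by exact: measurable_funB.
    by have := mf measurableT _ (measurable_norm_ge (3 * y / 8 * s)); rewrite setTI.
  - move=> x /= qyx; have := lerB_dist x m.
    have : 3 * y / 8 * s <= q * y / 2 by nra.
    have : 2 * q <= q * y / 2 by nra.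
    lra.
apply: le_trans (normal_prob_tail _ s0 _) _; first lra.
rewrite lee_fin ler_pM2l// ler_expR lerN2.
have -> : 3 * (3 * y / 8) ^+ 2 / 8 = 27 / 512 * y ^+ 2 by field.
have := sqr_ge0 y; lra.
Qed.

End gaussian_tail.

(** * Growth of fractional Brownian motion *)

Lemma expr_unbounded (R : realType) (g M : R) : 1 < g -> exists n, M <= g ^+ n.
Proof.
move=> g1; have d0 : 0 < g - 1 by rewrite subr_gt0.
have bern n : 1 + n%:R * (g - 1) <= g ^+ n.
  elim: n => [|n IH]; first by rewrite mul0r addr0.
  rewrite exprS -[n.+1]addn1 natrD mulrDl mul1r.
  have : 0 <= n%:R * (g - 1) :> R by rewrite mulr_ge0// ltW.
  nra.
exists (Num.truncn (`|M| / (g - 1))).+1; apply: le_trans (bern _).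
have /ltW : `|M| / (g - 1) < (Num.truncn (`|M| / (g - 1))).+1%:R.
  exact: truncnS_gt.
rewrite ler_pdivrMr//; have := ler_norm M; lra.
Qed.

(** A dyadic point is reached from 0 with at most one increment per level; the bounds form a
    geometric series, and continuity extends the estimate to all times. *)
Lemma dyadic_chaining (R : realType) (f : R -> R) (L A g : R) :
  continuous f -> 0 < L -> 1 < g ->
  (forall k j, (j < 2 ^ k)%N ->
    `|f (L * j.+1%:R / 2 ^+ k) - f (L * j%:R / 2 ^+ k)| <= A / g ^+ k) ->
  forall t, 0 <= t <= L -> `|f t - f 0| <= A * (g / (g - 1)).
Proof.
move=> cf L0 g1 Hf.
have g0 : 0 < g by exact: lt_trans g1.
have d0 : 0 < g - 1 by rewrite subr_gt0.
have A0 : 0 <= A by have := Hf 0%N 0%N isT; rewrite !expr0 !divr1; exact: le_trans.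
have gk k : 0 < g ^+ k by rewrite exprn_gt0.
(* The right-hand side is [A] times the exact sum of [g ^- i] for [i <= k]. *)
have dyadic k j : (j <= 2 ^ k)%N ->
    `|f (L * j%:R / 2 ^+ k) - f 0| <= A * (g - (g ^+ k)^-1) / (g - 1).
  elim: k j => [|k IH] j.
    rewrite expn0 !expr0 invr1 mulr1 mulfK ?gt_eqF//.
    case: j => [|[|//]] _; first by rewrite mulr0 subrr normr0.
    by have := Hf 0%N 0%N isT; rewrite !expr0 !divr1 mulr0.
  have half i : L * (i.*2)%:R / 2 ^+ k.+1 = L * i%:R / 2 ^+ k.
    by rewrite -muln2 natrM exprS; field; rewrite expf_neq0.
  have E : A * (g - (g ^+ k.+1)^-1) / (g - 1) =
      A * (g - (g ^+ k)^-1) / (g - 1) + A / g ^+ k.+1.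
    by rewrite exprS; field; rewrite !gt_eqF.
  have Agk : 0 <= A / g ^+ k.+1 by rewrite divr_ge0// ltW.
  (* An even node belongs to the previous level; an odd one is a single increment past such a
     node. *)
  rewrite -(odd_double_half j) E; case: (odd j) => /= jk; last first.
    rewrite add0n half; apply: le_trans (IH _ _) _; last by rewrite lerDl.
    by move: jk; rewrite add0n expnS mul2n leq_double.
  rewrite add1n; apply: le_trans (ler_distD (f (L * (j./2).*2%:R / 2 ^+ k.+1)) _ _) _.
  rewrite addrC; apply: lerD; last by apply: Hf; move: jk; rewrite add1n.
  rewrite half; apply: IH; move: jk; rewrite add1n expnS mul2n => jk.
  by rewrite -leq_double ltnW.
move=> t /andP[t0 tL]; rewrite leNgt; apply/negP => gap.
set M := A * (g / (g - 1)) in gap.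
have e0 : 0 < `|f t - f 0| - M by rewrite subr_gt0.
have ft : nbhs t [set u | `|f t - f u| < `|f t - f 0| - M].
  by have /cvgrPdist_lt := @cf t; apply.
move: ft => /nbhs_ballP[r /= r0 Hr].
have [k Hk] := @expr_unbounded R 2 (2 * L / r) (ltr1n R 2).
have k0 : 0 < 2 ^+ k :> R by rewrite exprn_gt0.
(* The last level-k node before [t], at distance at most [L / 2 ^+ k < r]. *)
pose j := Num.truncn (t * 2 ^+ k / L).
have z0 : 0 <= t * 2 ^+ k / L by rewrite divr_ge0 ?(ltW L0)// mulr_ge0 ?(ltW k0).
have /andP[j1 j2] := truncn_itv z0; rewrite -/j in j1 j2.
have jk : (j <= 2 ^ k)%N.
  rewrite -(ler_nat R) natrX; apply: le_trans j1 _.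
  by rewrite ler_pdivrMr// mulrC ler_pM2l.
pose u := L * j%:R / 2 ^+ k.
have ut : u <= t.
  by rewrite /u ler_pdivrMr// mulrC -ler_pdivlMr.
have tu : t - u < r.
  have : t < L * j.+1%:R / 2 ^+ k.
    by rewrite ltr_pdivlMr// mulrC [ltRHS]mulrC -ltr_pdivrMr// mulrC.
  rewrite -[j.+1]addn1 natrD mulrDr mulrDl mulr1 -/u => h.
  have : L / 2 ^+ k < r.
    rewrite ltr_pdivrMr// mulrC -ltr_pdivrMr//; apply: lt_le_trans Hk.
    rewrite ltr_pM2r ?invr_gt0//; lra.
  lra.
have : `|f t - f u| < `|f t - f 0| - M.
  by apply: Hr; rewrite /ball/= ger0_norm ?subr_ge0.
have := dyadic _ _ jk; rewrite -/u.
have : A * (g - (g ^+ k)^-1) / (g - 1) <= M.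
  rewrite /M -mulrA ler_wpM2l// ler_pM2r ?invr_gt0// gerBl invr_ge0 ltW//.
have := ler_distD (f u) (f t) (f 0); lra.
Qed.

(** * Moments and tails of the increments *)

Section fbm_increments.
Context (d : measure_display) (T : measurableType d) (R : realType).
Variables (P : probability T R) (H : R) (B : R -> {RV P >-> R}).
Hypotheses (H0 : 0 < H) (fbm : fractional_brownian_motion H B).
Local Notation cov s t := (fun w : T => (B s w * B t w)%R%:E).

Let cov_measurable s t : measurable_fun [set: T] (cov s t).
Proof. by apply/measurable_EFinP; apply: measurable_funM. Qed.

Lemma fbm_covE s t : 0 <= s -> 0 <= t ->
  (\int[P]_w (B s w * B t w)%:E =
   (2^-1 * (s `^ (2 * H) + t `^ (2 * H) - `|s - t| `^ (2 * H)))%:E)%E.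
Proof. by case: fbm => _ _ + s0 t0 => /(_ s t s0 t0); rewrite unlock. Qed.

Lemma fbm_varE t : 0 <= t -> (\int[P]_w (B t w * B t w)%:E = (t `^ (2 * H))%:E)%E.
Proof.
move=> t0; rewrite fbm_covE// subrr normr0 powR0 ?mulf_neq0 ?gt_eqF//.
by congr EFin; field.
Qed.

Lemma integrable_fbm_sqr t : 0 <= t -> P.-integrable [set: T] (cov t t).
Proof.
move=> t0; apply/integrableP; split; first exact: cov_measurable.
under eq_integral do rewrite gee0_abs ?lee_fin -?expr2 ?sqr_ge0// expr2.
by rewrite fbm_varE// ltry.
Qed.

(** The product is dominated by the sum of the squares; integrability is needed to expand the
    squared increment by linearity. *)
Lemma integrable_fbm_prod s t : 0 <= s -> 0 <= t ->
  P.-integrable [set: T] (cov s t).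
Proof.
move=> s0 t0.
apply: (@le_integrable _ _ _ P _ measurableT _ (cov s s \+ cov t t)%E).
- exact: cov_measurable.
- move=> w _; rewrite /= lee_fin [leRHS]ger0_norm; last first.
    by rewrite -!expr2 addr_ge0// sqr_ge0.
  have := sqr_ge0 (`|B s w| - `|B t w|).
  rewrite normrM -!expr2 -(real_normK (num_real (B s w))).
  rewrite -(real_normK (num_real (B t w))).
  have := normr_ge0 (B s w); have := normr_ge0 (B t w); nra.
- by apply: integrableD => //; exact: integrable_fbm_sqr.
Qed.

Lemma fbm_incr_varE s t : 0 <= s -> 0 <= t ->
  (\int[P]_w ((B t w - B s w) ^+ 2)%:E = (`|t - s| `^ (2 * H))%:E)%E.
Proof.
move=> s0 t0.
have -> : (fun w => ((B t w - B s w) ^+ 2)%:E) =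
    ((cov t t \+ cov s s) \+ (fun w => (- 2)%:E * cov t s w))%E.
  by apply/funext => w /=; rewrite -EFinM -!EFinD; congr EFin; ring.
rewrite integralD//; last 2 first.
- by apply: integrableD => //; exact: integrable_fbm_sqr.
- by apply: integrableZl => //; exact: integrable_fbm_prod.
rewrite integralD//; [|exact: integrable_fbm_sqr..].
rewrite integralZl//; last exact: integrable_fbm_prod.
rewrite !fbm_varE// fbm_covE// -EFinM -!EFinD; congr EFin.
by field.
Qed.

Lemma fbm_incr_law s t : 0 <= s -> 0 <= t ->
  gaussian_law (pushforward P (fun w => B t w - B s w)).
Proof.
move=> s0 t0; case: fbm => G _ _.
have := G 2 (fun i => if i == ord0 then s else t)
            (fun i => if i == ord0 then -1 else 1).
have -> : (fun w => \sum_(i < 2) (if i == ord0 then -1 else 1) *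
    B (if i == ord0 then s else t) w) = (fun w => B t w - B s w).
  by apply/funext => w; rewrite !big_ord_recl big_ord0/=; ring.
by apply => i; case: ifP.
Qed.

(** With [q] equal to two root mean squares of the increment, Chebyshev's inequality leaves mass at
    most 1/4 outside, as [gaussian_law_tail] requires. *)
Lemma fbm_incr_tail s t y : 0 <= s -> 0 <= t -> s != t -> 4 <= y ->
  (P [set w | (2 * `|t - s| `^ H * y <= `|B t w - B s w|)%R] <=
   (2 * expR (- (y ^+ 2 / 32)))%:E)%E.
Proof.
move=> s0 t0 st y4; set q := 2 * `|t - s| `^ H.
have ts0 : 0 < `|t - s| by rewrite normr_gt0 subr_eq0 eq_sym.
have q0 : 0 < q by rewrite mulr_gt0// powR_gt0.
have qq : q ^+ 2 = 4 * `|t - s| `^ (2 * H).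
  by rewrite exprMn (mulrC 2 H) powRrM powR_mulrn ?powR_ge0//; ring.
apply: (gaussian_law_tail (fbm_incr_law s0 t0) q0 y4).
have f_nd : {in Num.nneg &, {homo (fun x : R => x ^+ 2) : x y / x <= y}}.
  by move=> u v u0 v0 uv; rewrite ler_pXn2r.
have mf : measurable_fun [set: R] (fun x : R => x ^+ 2) by exact: measurable_funX.
have := @markov _ _ _ P (B t \- B s)%R _ q q0 mf (fun r _ => sqr_ge0 r) f_nd.
rewrite unlock /=.
under eq_integral do rewrite /= real_normK ?num_real//.
rewrite fbm_incr_varE// qq.
have h0 : 0 < `|t - s| `^ (2 * H) by rewrite powR_gt0.
rewrite -lee_pdivlMl ?mulr_gt0// -EFinM.
have -> : (4 * `|t - s| `^ (2 * H))^-1 * `|t - s| `^ (2 * H) = 4^-1.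
  by field; rewrite gt_eqF.
by under eq_set do rewrite lee_fin.
Qed.

End fbm_increments.

(** * From dyadic scales to all times, and elementary power bounds *)

Lemma sub_sqrt_of_geometric (R : realType) (f : R -> R) (C be : R) n0 :
  0 < be -> be ^+ 2 < 2 -> 0 <= C ->
  (forall N, (n0 <= N)%N -> forall t, 0 <= t <= 2 ^+ N -> `|f t| <= C * be ^+ N) ->
  sub_sqrt f.
Proof.
move=> be0 be2 C0 Hf e e0.
have eta1 : 1 < 2 / be ^+ 2 by rewrite ltr_pdivlMr ?mul1r ?exprn_gt0.
(* For [N >= n1] this is the square of [C * be ^+ N.+1 <= e * sqrt (2 ^+ N)]. It suffices because
   [T] will lie between [2 ^+ N] and [2 ^+ N.+1]. *)
have [n1 Hn1] := expr_unbounded (C ^+ 2 * be ^+ 2 / e ^+ 2) eta1.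
pose M := maxn n0 n1; exists (2 ^+ M); first by rewrite exprn_gt0.
move=> T MT u /andP[u0 uT].
have T0 : 0 <= T by apply: le_trans MT; rewrite exprn_ge0.
pose n := Num.truncn T; have /andP[nT Tn] := truncn_itv T0; rewrite -/n in nT Tn.
have Mn : (2 ^ M <= n)%N.
  by rewrite -ltnS -(ltr_nat R) natrX; apply: le_lt_trans MT Tn.
have n_gt0 : (0 < n)%N by apply: leq_trans Mn; rewrite expn_gt0.
pose N := trunc_log 2 n.
have /andP[N1 N2] : (2 ^ N <= n < 2 ^ N.+1)%N by exact: trunc_log_bounds.
have MN : (M <= N)%N by exact: trunc_log_max.
have NT : 2 ^+ N <= T.
  by apply: le_trans nT; rewrite -natrX ler_nat.
have TN : T <= 2 ^+ N.+1.
  by apply: le_trans (ltW Tn) _; rewrite -natrX ler_nat.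
have n0N : (n0 <= N.+1)%N.
  by apply: leq_trans (leqW MN); rewrite leq_maxl.
apply: le_trans (Hf _ n0N u _) _; first by rewrite u0 (le_trans uT).
rewrite -(@ler_pXn2r _ 2)// ?nnegrE ?mulr_ge0 ?sqrtr_ge0 ?exprn_ge0 ?(ltW be0) ?(ltW e0)//.
rewrite !exprMn sqr_sqrtr//.
apply: (@le_trans _ _ (e ^+ 2 * 2 ^+ N)); last by rewrite ler_pM2l ?exprn_gt0.
have HN : C ^+ 2 * be ^+ 2 / e ^+ 2 <= (2 / be ^+ 2) ^+ N.
  apply: le_trans Hn1 _; rewrite ler_weXn2l// ?(ltW eta1)//.
  by apply: leq_trans MN; rewrite leq_maxr.
move: HN; rewrite expr_div_n ler_pdivlMr ?exprn_gt0// => HN.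
have -> : C ^+ 2 * (be ^+ N.+1) ^+ 2 =
    (C ^+ 2 * be ^+ 2 / e ^+ 2 * (be ^+ 2) ^+ N) * e ^+ 2.
  have -> : (be ^+ N.+1) ^+ 2 = be ^+ 2 * (be ^+ 2) ^+ N.
    by rewrite -exprM mulnC exprM exprS.
  by field; rewrite gt_eqF.
by rewrite [leRHS]mulrC ler_pM2r ?exprn_gt0.
Qed.

(** One term of the exponential series bounds [expR v] from below; exponential decay is thus traded
    for any power. *)
Lemma expRN_le_powV (R : realType) (v : R) n : 0 < v ->
  expR (- v) <= n.+1`!%:R / v ^+ n.+1.
Proof.
move=> v0; rewrite expRN -invf_div lef_pV2 ?posrE ?expR_gt0//; last first.
  by rewrite divr_gt0 ?exprn_gt0// ltr0n fact_gt0.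
apply: le_trans (expR_ge1Dxn n (ltW v0)); rewrite lerDr//.
Qed.

Lemma powR_exprn (R : realType) (c r : R) n : 0 <= c ->
  (c ^+ n) `^ r = (c `^ r) ^+ n.
Proof.
by move=> c0; rewrite -powR_mulrn// -powRrM mulrC powRrM powR_mulrn// powR_ge0.
Qed.

Lemma powR2_gt1 (R : realType) (x : R) : 0 < x -> 1 < 2 `^ x.
Proof.
move=> x0; rewrite -[ltLHS](congr1 (@^~ x) (powR1 R)).
by apply: gt0_ltr_powR; rewrite ?nnegrE// ltr1n.
Qed.

(** * Chaining and Borel-Cantelli over the scales [2 ^+ N] *)

Section fbm_growth.
Context (d : measure_display) (T : measurableType d) (R : realType).
Variables (P : probability T R) (H : R) (B : R -> {RV P >-> R}).
Hypotheses (H0 : 0 < H) (H2 : H < 2^-1) (fbm : fractional_brownian_motion H B).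

(* [ga] and [rho] are such that an increment over a time [2^N / 2^k] has
   standard deviation [(ga^2)^N / (ga^2)^k]; the level-k threshold exceeds it by
   a factor of order [rho^N ga^k]. *)
Let ga : R := 2 `^ (H / 2).
Let rho : R := 2 `^ ((2^-1 - H) / 2).

Let ga1 : 1 < ga.
Proof. by apply: powR2_gt1; rewrite divr_gt0. Qed.

Let rho1 : 1 < rho.
Proof. by apply: powR2_gt1; rewrite divr_gt0// subr_gt0. Qed.

Let ga0 : 0 < ga. Proof. exact: lt_trans ga1. Qed.
Let rho0 : 0 < rho. Proof. exact: lt_trans rho1. Qed.

Let ga_sqr : ga ^+ 2 = 2 `^ H.
Proof.
by rewrite -powR_mulrn ?powR_ge0// -powRrM divfK.
Qed.

(** The left side is 2 to the power [1/2 + H], so [H < 1/2] makes the thresholds grow more slowly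
    than the square root of [2 ^+ N]. *)
Let rho_ga_lt : (rho * ga ^+ 2) ^+ 2 < 2.
Proof.
rewrite exprMn ga_sqr -!powR_mulrn ?powR_ge0// -!powRrM -powRD; last first.
  by apply/implyP.
set z := (X in 2 `^ X < _).
have zE : z = 2^-1 + H by rewrite /z; field.
have E : 2 `^ z * 2 `^ (2^-1 - H) = 2 :> R.
  rewrite -powRD; last exact/implyP.
  by rewrite zE (_ : _ + _ = 1) ?powRr1//; field.
by rewrite -[ltRHS]E ltr_pMr ?powR_gt0// powR2_gt1// subr_gt0.
Qed.

Let node (N k j : nat) : R := 2 ^+ N * j%:R / 2 ^+ k.

(** The threshold has the shape [A / g ^+ k] required by [dyadic_chaining], with [g = ga]. *)
Definition bad_incr (N k j : nat) : set T :=
  [set w | 8 * (rho * ga ^+ 2) ^+ N / ga ^+ k <=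
           `|B (node N k j.+1) w - B (node N k j) w|].

Lemma measurable_bad_incr N k j : measurable (bad_incr N k j).
Proof.
have mf : measurable_fun [set: T]
    (fun w => B (node N k j.+1) w - B (node N k j) w).
  exact: measurable_funB.
have := mf measurableT _ (measurable_norm_ge (8 * (rho * ga ^+ 2) ^+ N / ga ^+ k)).
by rewrite setTI.
Qed.

Lemma bad_incr_tail N k j : (P (bad_incr N k j) <=
  (2 * expR (- ((rho ^+ 2) ^+ N * (ga ^+ 2) ^+ k / 2)))%:E)%E.
Proof.
have node0 i : 0 <= node N k i by rewrite divr_ge0 ?mulr_ge0 ?exprn_ge0.
have nodeB : node N k j.+1 - node N k j = 2 ^+ N / 2 ^+ k.
  by rewrite /node -[j.+1]addn1 natrD; field; rewrite expf_neq0.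
have nodeB0 : 0 < node N k j.+1 - node N k j.
  by rewrite nodeB divr_gt0 ?exprn_gt0.
(* Twice the standard deviation times [y] is exactly the threshold. *)
pose y := 4 * rho ^+ N * ga ^+ k.
have y4 : 4 <= y.
  rewrite /y -mulrA ler_peMr// mulr_ege1// exprn_ege1// ltW//.
have nodeN : node N k j != node N k j.+1.
  by rewrite eq_sym -subr_eq0 gt_eqF.
have := fbm_incr_tail H0 fbm (node0 j) (node0 j.+1) nodeN y4.
have -> : 2 * `|node N k j.+1 - node N k j| `^ H * y =
    8 * (rho * ga ^+ 2) ^+ N / ga ^+ k.
  rewrite (gtr0_norm nodeB0) nodeB.
  have E : (2 ^+ N / 2 ^+ k) `^ H * (ga ^+ 2) ^+ k = (ga ^+ 2) ^+ N.
    rewrite ga_sqr -!powR_exprn// -powRM ?exprn_ge0// ?divr_ge0 ?exprn_ge0//.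
    by rewrite divfK// expf_neq0.
  rewrite exprMn -E /y -exprM mulnC exprM; field.
  by rewrite expf_neq0// gt_eqF.
have -> : y ^+ 2 / 32 = (rho ^+ 2) ^+ N * (ga ^+ 2) ^+ k / 2.
  have E c n : (c ^+ 2) ^+ n = (c ^+ n) ^+ 2 :> R by rewrite -!exprM mulnC.
  by rewrite /y !E; field.
exact.
Qed.

(** A large enough power in [expRN_le_powV] gives decay [4 ^- k] in the level, which beats the
    [2 ^ k] increments of that level, and [2 ^- N] in the scale, summable for Borel-Cantelli. *)
Lemma bad_incr_summable : exists2 C : R, 0 <= C &
  forall N k j, (P (bad_incr N k j) <= (C / (2 ^+ N * 4 ^+ k))%:E)%E.
Proof.
have gg1 : 1 < ga ^+ 2 by rewrite exprn_egt1.
have rr1 : 1 < rho ^+ 2 by rewrite exprn_egt1.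
have [p1 Hp1] := expr_unbounded 4 gg1; have [p2 Hp2] := expr_unbounded 2 rr1.
pose p := maxn p1 p2.
have Hg : 4 <= (ga ^+ 2) ^+ p.+1.
  apply: le_trans Hp1 _; rewrite ler_weXn2l ?(ltW gg1)//.
  by rewrite leqW// leq_maxl.
have Hr : 2 <= (rho ^+ 2) ^+ p.+1.
  apply: le_trans Hp2 _; rewrite ler_weXn2l ?(ltW rr1)//.
  by rewrite leqW// leq_maxr.
pose K : R := 2 * p.+1`!%:R * 2 ^+ p.+1.
have K0 : 0 <= K by rewrite !mulr_ge0 ?exprn_ge0.
exists K => // N k j; apply: le_trans (bad_incr_tail N k j) _; rewrite lee_fin.
set v := (rho ^+ 2) ^+ N * (ga ^+ 2) ^+ k / 2.
have v0 : 0 < v by rewrite divr_gt0 ?mulr_gt0 ?exprn_gt0.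
have vp : 2 ^+ N * 4 ^+ k / 2 ^+ p.+1 <= v ^+ p.+1.
  rewrite /v expr_div_n ler_pM2r ?invr_gt0 ?exprn_gt0// exprMn.
  have E c n : (c ^+ n) ^+ p.+1 = (c ^+ p.+1) ^+ n :> R by rewrite -!exprM mulnC.
  rewrite (E (rho ^+ 2)) (E (ga ^+ 2)); apply: ler_pM; rewrite ?exprn_ge0//.
    by apply: lerXn2r; rewrite ?nnegrE// (le_trans _ Hr).
  by apply: lerXn2r; rewrite ?nnegrE// (le_trans _ Hg).
have v20 : 0 < 2 ^+ N * 4 ^+ k / 2 ^+ p.+1 :> R.
  by rewrite divr_gt0 ?mulr_gt0 ?exprn_gt0.
apply: (@le_trans _ _ (2 * (p.+1`!%:R / v ^+ p.+1))).
  by rewrite ler_pM2l// expRN_le_powV.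
apply: (@le_trans _ _ (2 * (p.+1`!%:R / (2 ^+ N * 4 ^+ k / 2 ^+ p.+1)))).
  rewrite ler_pM2l// ler_wpM2l// lef_pV2 ?posrE ?exprn_gt0//.
rewrite le_eqVlt; apply/orP; left; apply/eqP; rewrite /K; field.
by rewrite !expf_neq0.
Qed.

Definition bad_level N k := \big[setU/set0]_(j < 2 ^ k) bad_incr N k j.

Lemma measurable_bad_level N k : measurable (bad_level N k).
Proof. by apply: bigsetU_measurable => j _; exact: measurable_bad_incr. Qed.

Definition bad_scale N := \bigcup_k bad_level N k.

Lemma measurable_bad_scale N : measurable (bad_scale N).
Proof. by apply: bigcup_measurable => k _; exact: measurable_bad_level. Qed.

Lemma bad_scale_null : P (lim_sup_set bad_scale) = 0%E.
Proof.
have [C C0 HC] := bad_incr_summable.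
(* The factor [2 ^ k.+1] is the form in which [epsilon_trick0] sums the geometric series over
   [k]. *)
have level N k : (P (bad_level N k) <= (2 * C / 2 ^+ N / (2 ^ k.+1)%:R)%:E)%E.
  apply: le_trans; first apply: Boole_inequality.
    by move=> j _; exact: measurable_bad_incr.
  apply: (@le_trans _ _ (\sum_(j < 2 ^ k) (C / (2 ^+ N * 4 ^+ k))%:E)%E).
    by apply: lee_sum => j _; exact: HC.
  rewrite sumEFin lee_fin sumr_const card_ord -[leLHS]mulr_natr le_eqVlt.
  apply/orP; left; apply/eqP; rewrite !natrX exprS.
  have -> : 4 ^+ k = 2 ^+ k * 2 ^+ k :> R by rewrite -exprMn; congr (_ ^+ _); ring.
  by field; rewrite !expf_neq0.
have scale N : (P (bad_scale N) <= (4 * C / (2 ^ N.+1)%:R)%:E)%E.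
  apply: le_trans; first apply: generalized_Boole_inequality.
  - by move=> k; exact: measurable_bad_level.
  - exact: measurable_bad_scale.
  apply: (@le_trans _ _ (\sum_(k <oo) (2 * C / 2 ^+ N / (2 ^ k.+1)%:R)%:E)%E).
    by apply: lee_nneseries => // k _; exact: level.
  apply: le_trans; first apply: epsilon_trick0.
    by rewrite divr_ge0 ?mulr_ge0 ?exprn_ge0.
  rewrite lee_fin natrX exprS le_eqVlt; apply/orP; left; apply/eqP; field.
  by rewrite expf_neq0.
apply: lim_sup_set_cvg0; first exact: measurable_bad_scale.
apply: (@le_lt_trans _ _ (4 * C)%:E); last exact: ltry.
apply: le_trans; last by apply: (@epsilon_trick0 _ _ xpredT); rewrite mulr_ge0.
by apply: lee_nneseries => // N _; exact: scale.
Qed.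

Lemma fbm0 : {ae P, forall w, B 0 w = 0}.
Proof.
have mf : measurable_fun [set: T] (fun w => (B 0 w ^+ 2)%:E).
  by apply/measurable_EFinP; apply: measurable_funX.
have E0 : (\int[P]_(w in [set: T]) `|(B 0 w ^+ 2)%:E| = 0)%E.
  under eq_integral do rewrite gee0_abs ?lee_fin ?sqr_ge0// expr2.
  by rewrite (fbm_varE H0 fbm)// powR0// mulf_neq0// gt_eqF.
have /(ae_eq_integral_abs P measurableT mf) := E0.
apply: filterS => w /(_ I) /= [] /eqP; rewrite sqrf_eq0 => /eqP.
exact.
Qed.

(** Outside a null set no scale from some [n0] on has a bad increment; chaining then bounds the path
    on [[0, 2 ^+ N]] by a constant times [(rho * ga ^+ 2) ^+ N]. *)
Lemma fbm_sub_sqrt :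
  (forall w, continuous (fun t : R => B (Num.max t 0) w)) ->
  {ae P, forall w, B 0 w = 0 /\ sub_sqrt (fun t => B t w)}.
Proof.
move=> cB; have lim0 : {ae P, forall w, ~ lim_sup_set bad_scale w}.
  exists (lim_sup_set bad_scale); split; last by move=> w /= /contrapT.
  - apply: bigcap_measurable => [|n _]; first by exists 0%N.
    apply: bigcup_measurable => m _.
    exact: measurable_bad_scale.
  - exact: bad_scale_null.
apply: filterS2 fbm0 lim0 => w B0 good; split => //.
have [n0 Hn0] : exists n0, forall N, (n0 <= N)%N -> ~ bad_scale N w.
  move: good => /existsNP[n0 /not_implyP[_ Hn0]]; exists n0 => N n0N bad.
  by apply: Hn0; exists N.
have be0 : 0 < rho * ga ^+ 2 by rewrite mulr_gt0// exprn_gt0.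
have gg0 : 0 <= ga / (ga - 1) by rewrite divr_ge0 ?subr_ge0 ?(ltW ga0) ?(ltW ga1).
apply: (@sub_sqrt_of_geometric _ _ (8 * (ga / (ga - 1))) _ n0 be0 rho_ga_lt).
  by rewrite mulr_ge0.
move=> N n0N t /andP[t0 tN].
have := @dyadic_chaining _ _ (2 ^+ N) (8 * (rho * ga ^+ 2) ^+ N) ga (cB w) _ ga1.
rewrite exprn_gt0// => /(_ isT) chain.
have := chain _ t; rewrite (max_idPl t0) maxxx B0 subr0 t0 tN mulrAC.
apply => // k j jk.
have n0' i : 0 <= 2 ^+ N * i%:R / 2 ^+ k :> R.
  by rewrite divr_ge0 ?mulr_ge0 ?exprn_ge0.
rewrite !(max_idPl (n0' _)) leNgt; apply/negP => big.
apply: (Hn0 _ n0N); exists k => //; rewrite /bad_level -bigcup_mkord.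
by exists j => //=; exact: ltW.
Qed.

End fbm_growth.

(** * Continuity of the noise and the almost sure conclusion *)

Lemma locally_holder_continuous (R : realType) (la : R) (f : R -> R) : 0 < la ->
  locally_holder la f -> {within `[0, +oo[, continuous f}.
Proof.
move=> la0 hf; apply/subspace_continuousP => t /=; rewrite in_itv/= andbT => t0.
have [C HC] := hf (t + 1) (ltr_wpDl t0 ltr01).
apply/cvgrPdist_le => e e0; rewrite near_withinE.
pose D := `|C| + 1; have D0 : 0 < D by rewrite ltr_wpDl.
pose r := Num.min 1 ((e / D) `^ la^-1).
have r0 : 0 < r by rewrite lt_min ltr01 powR_gt0// divr_gt0.
have r1 : r <= 1 by rewrite ge_min lexx.
have rla : r `^ la <= e / D.
  apply: (@le_trans _ _ (((e / D) `^ la^-1) `^ la)).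
    apply: ge0_ler_powR; rewrite ?nnegrE ?powR_ge0 ?(ltW la0) ?(ltW r0)//.
    by rewrite ge_min lexx orbT.
  by rewrite -powRrM mulVf ?gt_eqF// powRr1// divr_ge0// ltW.
near=> u => /=; rewrite in_itv/= andbT => u0.
have tu : `|t - u| < r by near: u; exact: nbhsx_ballx.
have tu1 : u <= t + 1 by move: tu; rewrite ltr_norml => /andP[]; lra.
have t01 : 0 <= t <= t + 1 by rewrite t0 lerDl ler01.
have u01 : 0 <= u <= t + 1 by rewrite u0.
apply: le_trans (HC u t u01 t01) _.
apply: (@le_trans _ _ (D * (e / D))); last by rewrite mulrC divfK// gt_eqF.
have p0 := powR_ge0 `|t - u| la.
apply: (@le_trans _ _ (D * `|t - u| `^ la)).
  by rewrite ler_wpM2r// (le_trans (ler_norm C))// lerDl.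
rewrite ler_pM2l//; apply: le_trans rla.
by apply: ge0_ler_powR; rewrite ?nnegrE ?(ltW la0) ?(ltW r0) ?(ltW tu).
Unshelve. all: by end_near. Qed.

Theorem theorem4p4 (R : realType) (d : measure_display)
    (Omega : measurableType d) (P : probability Omega R)
    (H x0 a sigma : R) (B : R -> {RV P >-> R}) (Xe : R -> R -> Omega -> R)
    (H_gt0 : 0 < H) (H_lt_half : H < 2^-1)
    (x0_gt0 : 0 < x0) (a_gt0 : 0 < a) (sigma_gt0 : 0 < sigma)
    (fbm : fractional_brownian_motion H B)
    (holder : forall (w : Omega) (lambda : R), 0 < lambda -> lambda < H ->
      locally_holder lambda (fun t => B t w))
    (Xe_sol : forall (eps : R) (w : Omega), 0 < eps ->
      approx_bessel_path x0 a sigma eps (fun t => B t w)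
        (fun t => Xe eps t w)) :
  {ae P, forall w : Omega,
    drift_estimator (rough_bessel (fun eps t => Xe eps t w)) T
      @[T --> +oo] --> a%:E}.
Proof.
have Hh0 : 0 < H / 2 by rewrite divr_gt0.
have HhH : H / 2 < H by lra.
have cB w : {within `[0, +oo[, continuous (fun t => B t w)}.
  exact: (locally_holder_continuous Hh0 (holder w _ Hh0 HhH)).
(* The exceptional null set comes from here alone; the rest is pathwise. *)
have := fbm_sub_sqrt H_gt0 H_lt_half fbm (fun w => continuous_comp_max0 (cB w)).
apply: filterS => w [B0 sB].
by apply: (drift_estimator_cvg x0_gt0 a_gt0 sigma_gt0 (cB w) B0 sB) => eps; exact: Xe_sol.
Qed.
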